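(* Let $k$ be a positive integer and $F=\{1,2,\dots,k\}$. Let $a,c$ be real numbers with $a\neq 0,1$, $c\neq 0,-1,-2,\dots$, and $$m_k^{1/a,-c-k+1}(-n)\neq 0\quad\text{for all } n\ge 1,$$ where $m_k^{1/a,-c-k+1}$ is a Meixner polynomial. Put $\mathfrak{p}_{-c-F}(x)=\prod_{j\in F}(x+c+j)$. Then the orthogonal polynomials $(q_n)_{n\ge 0}$ with respect to $\mathfrak{p}_{-c-F}\,\rho_{a,c}$, where $\rho_{a,c}$ is the moment functional for the Meixner polynomials, are common eigenfunctions of a difference operator of order $2k+2$ and genre $(-k-1,k+1)$; that is, there are such an operator $D$ and numbers $\lambda_n$ with $D(q_n)=\lambda_nq_n$ for all $n\ge 0$.
   Context: For $l\in\mathbb{Z}$ the shift operator $\mathfrak{s}_l$ acts on polynomials by $\mathfrak{s}_l(f)(x)=f(x+l)$. A finite difference operator $\sum_{l=s}^r f_l\,\mathfrak{s}_l$ (with polynomial coefficients $f_l$ independent of $n$) with $f_s,f_r\neq 0$ has order $r-s$ and genre $(s,r)$. Meixner polynomials (for $a\neq 0,1$ and any real $c$): $m_n^{a,c}(x)=(-1)^n\sum_{j=0}^na^{-j}\binom{x}{j}\binom{-x-c}{n-j}$. A moment functional is a linear map $\mu:\mathbb{P}\to\mathbb{R}$ on the space $\mathbb{P}$ of real polynomials; for a polynomial $r$, $\langle r\mu,p\rangle=\langle\mu,rp\rangle$. For $a\neq 0,1$ and $c\neq 0,-1,-2,\dots$, the Meixner moment functional $\rho_{a,c}$ is the unique moment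 functional with respect to which $(m_n^{a,c})_n$ are orthogonal, normalized by $\langle\rho_{a,c},1\rangle=\Gamma(c)$ (for $0<|a|<1$ it is given by the measure $(1-a)^c\sum_{x=0}^\infty\frac{a^x\Gamma(x+c)}{x!}\delta_x$). Orthogonal polynomials with respect to $\mu$ are polynomials $(q_n)_n$ with $\deg q_n=n$, $\langle\mu,q_nx^m\rangle=0$ for $0\le m<n$ and $\langle\mu,q_nx^n\rangle\neq 0$ (each $q_n$ is unique up to a nonzero constant factor). *)

(* Defs.v *)
From HB Require Import structures.
From mathcomp Require Import all_boot all_order all_algebra.
From mathcomp Require Import all_classical all_reals all_analysis.

Set Implicit Arguments.
Unset Strict Implicit.
Unset Printing Implicit Defensive.
Import Order.TTheory GRing.Theory Num.Theory.
Import numFieldNormedType.Exports.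
Local Open Scope classical_set_scope.
Local Open Scope ring_scope.

Definition shiftp (R : nzRingType) (l : int) (p : {poly R}) : {poly R} :=
  p \Po ('X + (l%:~R)%:P).

(* [D] is the operator [\sum_(s <= l <= r) f_l shift_l] with [f_s, f_r != 0];
   the sum over integers [l] is indexed by [l = s + i], [0 <= i <= r - s].  *)
Definition has_genre (R : nzRingType) (D : {poly R} -> {poly R}) (s r : int) :=
  s <= r /\
  exists f : int -> {poly R},
    [/\ f s != 0, f r != 0 &
        forall p, D p = \sum_(i < `|r - s|%N.+1) f (s + i%:Z) * shiftp (s + i%:Z) p].

Definition has_order (R : nzRingType) (D : {poly R} -> {poly R}) (N : int) :=
  exists s r : int, has_genre D s r /\ N = r - s.

Definition binomp (R : unitRingType) (u : {poly R}) (j : nat) : {poly R} :=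
  (j`!%:R)^-1 *: \prod_(i < j) (u - (i%:R)%:P).

Definition meixner (R : fieldType) (a c : R) (n : nat) : {poly R} :=
  (-1) ^+ n *: \sum_(j < n.+1)
     a ^- j *: (binomp 'X j * binomp (- 'X - c%:P) (n - j)).

Definition mul_functional (R : comNzRingType) (r : {poly R})
  (mu : {scalar {poly R}}) : {poly R} -> R := fun p => mu (r * p).

Lemma mul_functional_is_scalar (R : comNzRingType) (r : {poly R})
  (mu : {scalar {poly R}}) : scalar (mul_functional r mu).
Proof.
by move=> b p q; rewrite /mul_functional mulrDr -scalerAr linearP.
Qed.

HB.instance Definition _ (R : comNzRingType) (r : {poly R})
    (mu : {scalar {poly R}}) :=
  GRing.isLinear.Build R {poly R} R *%R (mul_functional r mu)
    (mul_functional_is_scalar r mu).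

Definition orthogonal_polys (R : nzRingType) (mu : {scalar {poly R}})
  (q : nat -> {poly R}) :=
  forall n, [/\ size (q n) = n.+1,
                forall m, (m < n)%N -> mu (q n * 'X^m) = 0 &
                mu (q n * 'X^n) != 0].

(* Euler's integral for [c > 0], extended to [c] not in {0, -1, -2, ...} by
   [Gamma c = Gamma (c + N) / (c (c + 1) ... (c + N - 1))], where [N] is the
   least natural number with [c + N > 0]. *)
Definition euler_integral (R : realType) (c : R) : R :=
  Rintegral lebesgue_measure `]0, +oo[ (fun t => t `^ (c - 1) * expR (- t)).

Definition Gamma (R : realType) (c : R) : R :=
  let N := if 0 < c then 0%N else (Num.truncn (- c)).+1 in
  euler_integral (c + N%:R) / \prod_(i < N) (c + i%:R).

Definition meixner_functional (R : realType) (a c : R)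
  (rho : {scalar {poly R}}) :=
  orthogonal_polys rho (meixner a c) /\ rho 1 = Gamma c.

(* The polynomial [p_{-c-F}]: the product of [x + c + j] over [j] in [F]. *)
Definition pshift (R : nzRingType) (c : R) (F : seq nat) : {poly R} :=
  \prod_(j <- F) ('X + c%:P + (j%:R)%:P).

(* Main.v *)
Require Import Defs.
From mathcomp Require Import all_boot all_order all_algebra.
From mathcomp Require Import all_classical all_reals all_analysis.
From mathcomp Require Import ring zify.
Import Order.TTheory GRing.Theory Num.Theory.
Local Open Scope ring_scope.

Set Implicit Arguments.
Unset Strict Implicit.
Unset Printing Implicit Defensive.

(** Write [y = x + c], [(y)_k = y (y + 1) ... (y + k - 1)], [C = c + k + 1] and
    [m_n] for the Meixner polynomial with parameters [a, C].

    The functional [mu = (y + 1)_k rho] lacks exactly the factor [y] to be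
    [(y)_{k+1} rho], for which the [m_n] are orthogonal.  Hence [q_n] is a
    combination of [m_n] and [m_{n-1}] only: such a combination is orthogonal to
    [y r] as soon as [deg r < n - 1], so it only has to be made orthogonal
    to [1].  With [u_n = mu(m_n)] this gives [q_n = m_n - (u_n / u_{n-1}) m_{n-1}].

    The number [u_n] is a polynomial in [n].  The Pearson equation
    [rho(x p(x)) = a rho((x + c) p(x + 1))] and the raising relation of the
    Meixner polynomials give a summation by parts that trades one degree of [m_n]
    for one difference of the test function ([pearson_meixner]).  Applied to the
    test function [1 / y], this yields [u_n = rho((y + n + 1)_k)] ([functional_pole_meixner]).
    As a function of [n] the right-hand side satisfies the same recurrence
    in [k] as [m_k^{1/a,-c-k+1}(-n-1)], because the Pearson equation and the raising
    relation have the same shape; so the two agree up to a nonzero constant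
    ([functional_poch_meixner]).  Call [U] this polynomial of degree [k]; the
    hypothesis says that [U(n) != 0], hence all [q_n] exist.

    For the operator, let [N] be the Meixner operator of genre [(-1, 1)] with
    [N m_n = n m_n], [Delta] the forward difference, and [P] the polynomial
    [P(t) = m_{k+1}^{1/a,-c-k}(-t)], for which [P(t+1) - P(t) = (a - 1) U(t)].  Put
    [D = P(N) - a Delta U(N)].  Since [Delta m_n] is [(1 - 1/a)] times the sum of
    all the [m_j] with [j < n],
      [D m_n = P(n) m_n - (a - 1) U(n) (m_0 + ... + m_{n-1})],
    and in [D(m_n - (U(n) / U(n-1)) m_{n-1})] the terms below [m_{n-1}] cancel,
    while by the choice of [P] the coefficient that remains at [m_{n-1}] is
    [- P(n) U(n) / U(n-1)].  Hence [D q_n = P(n) q_n].  The extreme coefficients of [D]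
    come from [P(N)], of degree [k + 1] in [N]; the contribution of [Delta U(N)]
    to the top coefficient has lower degree in [x] and cannot cancel it. *)

(** * Shifts of polynomials *)

Section Shift.
Variable R : comNzRingType.
Implicit Types (p q : {poly R}) (l : int).

Lemma shiftpD l p q : shiftp l (p + q) = shiftp l p + shiftp l q.
Proof. exact: comp_polyD. Qed.
Lemma shiftpN l p : shiftp l (- p) = - shiftp l p.
Proof. by rewrite /shiftp raddfN. Qed.
Lemma shiftpM l p q : shiftp l (p * q) = shiftp l p * shiftp l q.
Proof. exact: comp_polyM. Qed.
Lemma shiftp_sum l (I : finType) (F : I -> {poly R}) :
  shiftp l (\sum_i F i) = \sum_i shiftp l (F i).
Proof. exact: raddf_sum. Qed.
Lemma shiftpC l (b : R) : shiftp l b%:P = b%:P :> {poly R}.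
Proof. exact: comp_polyC. Qed.
Lemma shiftpX l : shiftp l 'X = 'X + (l%:~R)%:P :> {poly R}.
Proof. exact: comp_polyX. Qed.
Lemma shiftpZ l (b : R) p : shiftp l (b *: p) = b *: shiftp l p.
Proof. exact: comp_polyZ. Qed.
Lemma shiftp_shiftp l l' p : shiftp l (shiftp l' p) = shiftp (l + l') p.
Proof.
rewrite /shiftp -comp_polyA comp_polyD comp_polyX comp_polyC.
by rewrite -addrA -polyCD -intrD.
Qed.
Lemma shiftp0 p : shiftp 0 p = p.
Proof. by rewrite /shiftp addr0 comp_polyXr. Qed.
End Shift.

(** * Contiguous relations of the Meixner polynomials *)

Section MeixnerRelations.
Variable R : numFieldType.
Implicit Types (u v : {poly R}) (a c : R).

Lemma binomp0 u : binomp u 0 = 1.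
Proof. by rewrite /binomp big_ord0 fact0 invr1 scale1r. Qed.

Lemma fact_neq0 n : (n`!%:R : R) != 0.
Proof. by rewrite pnatr_eq0 -lt0n fact_gt0. Qed.

Lemma binomp_absorb u j :
  u * binomp (u - 1) j = j.+1%:R *: binomp u j.+1.
Proof.
rewrite /binomp factS natrM invfM scalerA mulVKf ?pnatr_eq0 //.
rewrite -scalerAr big_ord_recl subr0; congr (_ *: (_ * _)).
apply: eq_bigr => i _; rewrite lift0 -addrA -opprD; congr (u - _).
by rewrite -[1]/(1%:P) -polyCD nat1r.
Qed.

Lemma binomp_pascal u j :
  binomp (u + 1) j.+1 = binomp u j.+1 + binomp u j.
Proof.
apply: (@scalerI _ _ j.+1%:R); first by rewrite pnatr_eq0.
rewrite -binomp_absorb addrK scalerDr.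
rewrite /binomp factS natrM invfM scalerA mulVKf ?pnatr_eq0 //.
rewrite big_ord_recr /= -scalerAr scalerA (mulrC j.+1%:R) -scalerA -scalerDr.
by congr (_ *: _); rewrite -mul_polyC; ring.
Qed.

Lemma shiftp_binomp l u j : shiftp l (binomp u j) = binomp (shiftp l u) j.
Proof.
rewrite /binomp shiftpZ /shiftp rmorph_prod; congr (_ *: _).
by apply: eq_bigr => i _; rewrite rmorphB /= comp_polyC.
Qed.

(** The coefficient of [z^n] in [(1 + z / a)^u (1 + z)^v].  Keeping [u] and [v]
    free makes each contiguous relation below a statement about multiplying
    or differentiating this generating function. *)
Definition binconv a u v n : {poly R} :=
  \sum_(j < n.+1) a ^- j *: (binomp u j * binomp v (n - j)).

Lemma meixnerE a c n : meixner a c n = (-1) ^+ n *: binconv a 'X (- 'X - c%:P) n.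
Proof. by []. Qed.

Lemma binconv_pascalr a u v n :
  binconv a u (v + 1) n.+1 = binconv a u v n.+1 + binconv a u v n.
Proof.
rewrite /binconv big_ord_recr [in RHS]big_ord_recr /= addrAC -big_split /=.
congr (_ + _); last by rewrite subnn !binomp0.
apply: eq_bigr => i _; rewrite subSn ?leq_ord // binomp_pascal -scalerDr.
by rewrite mulrDr.
Qed.

Lemma binconv_pascall a u v n :
  binconv a (u + 1) v n.+1 = binconv a u v n.+1 + a^-1 *: binconv a u v n.
Proof.
rewrite /binconv big_ord_recl [in RHS]big_ord_recl /= -addrA scaler_sumr -big_split /=.
congr (_ + _); first by rewrite !binomp0.
apply: eq_bigr => i _; rewrite scalerA -invfM -exprS /bump leq0n add1n subSS binomp_pascal.
by rewrite -scalerDr mulrDl.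
Qed.

(** Derivative of the generating function with respect to [z]. *)
Lemma binconv_raise a u v n : a != 0 ->
  a *: (v * binconv a u (v - 1) n) + u * binconv a (u - 1) v n =
  (a * n.+1%:R) *: binconv a u v n.+1.
Proof.
move=> a0.
(* The two sums carry the weights [n + 1 - j] and [j], which add up to [n + 1]. *)
have e1 : a *: (v * binconv a u (v - 1) n) = \sum_(j < n.+2)
   (a * a ^- j * (n.+1 - j)%:R) *: (binomp u j * binomp v (n.+1 - j)).
  rewrite big_ord_recr /= subnn mulr0 scale0r addr0 /binconv mulr_sumr scaler_sumr.
  apply: eq_bigr => j _; rewrite subSn ?leq_ord //.
  rewrite -[in RHS]scalerA [in RHS]scalerAr -binomp_absorb -scalerAr scalerA.
  by rewrite mulrCA.
have e2 : u * binconv a (u - 1) v n = \sum_(j < n.+2)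
   (a * a ^- j * j%:R) *: (binomp u j * binomp v (n.+1 - j)).
  rewrite [RHS]big_ord_recl mulr0 scale0r add0r /binconv mulr_sumr.
  apply: eq_bigr => j _; rewrite lift0 subSS exprS invfM mulVKf //.
  by rewrite -[in RHS]scalerA [in RHS]scalerAl -binomp_absorb -scalerAr mulrA.
rewrite e1 e2 -big_split scaler_sumr /=; apply: eq_bigr => j _.
by rewrite -scalerDl scalerA -mulrDr -natrD subnK ?(leq_ord j) // mulrAC.
Qed.

Lemma meixner0 a c : meixner a c 0 = 1.
Proof.
by rewrite meixnerE /binconv big_ord1 !binomp0 mulr1 !expr0 invr1 !scale1r.
Qed.

(** Iterated, it shows that [meixner a (c + 1) n] is the sum of the [meixner a c j]
    for [j <= n]. *)
Lemma meixner_pascal a c n :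
  meixner a (c + 1) n.+1 = meixner a c n.+1 + meixner a (c + 1) n.
Proof.
rewrite !meixnerE.
have -> : (- 'X - c%:P) = (- 'X - (c + 1)%:P) + 1 :> {poly R} by ring.
by rewrite binconv_pascalr exprS mulN1r scaleNr scalerDr !scaleNr; ring.
Qed.

Lemma meixner_lower a c n :
  shiftp 1 (meixner a c n.+1) =
  meixner a c n.+1 + (1 - a^-1) *: meixner a (c + 1) n.
Proof.
have -> : shiftp 1 (meixner a c n.+1) =
  (-1) ^+ n.+1 *: binconv a ('X + 1) (- 'X - (c + 1)%:P) n.+1.
  rewrite meixnerE shiftpZ /binconv /shiftp raddf_sum; congr (_ *: _).
  apply: eq_bigr => i _; rewrite /= -!/(shiftp 1 _) shiftpZ shiftpM !shiftp_binomp.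
  by rewrite shiftpD !shiftpN shiftpX shiftpC; congr (_ *: (binomp _ _ * binomp _ _)); ring.
rewrite binconv_pascall.
have := meixner_pascal a c n; rewrite !meixnerE => e.
rewrite scalerDr e exprS -!mul_polyC; ring.
Qed.

(** The backward shift relation.  It yields both the Pearson equation of the
    functional and the recurrence that identifies the moments [u_n]. *)
Lemma meixner_raise a c n : a != 0 ->
  a *: (('X + c%:P) * meixner a (c + 1) n)
    - 'X * shiftp (- 1) (meixner a (c + 1) n) =
  (a * n.+1%:R) *: meixner a c n.+1.
Proof.
move=> a0.
have -> : shiftp (- 1) (meixner a (c + 1) n) =
  (-1) ^+ n *: binconv a ('X - 1) (- 'X - c%:P) n.
  rewrite meixnerE shiftpZ /binconv /shiftp raddf_sum; congr (_ *: _).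
  apply: eq_bigr => i _; rewrite /= -!/(shiftp (-1) _) shiftpZ shiftpM !shiftp_binomp.
  by rewrite shiftpD !shiftpN shiftpX shiftpC; congr (_ *: (binomp _ _ * binomp _ _)); ring.
rewrite [in RHS]meixnerE [RHS]scalerA [in RHS]mulrC -[RHS]scalerA -binconv_raise // meixnerE.
have -> : - 'X - (c + 1)%:P = - 'X - c%:P - 1 :> {poly R} by ring.
by rewrite exprS -!mul_polyC; ring.
Qed.

Lemma horner_meixner_raise a c n x : a != 0 ->
  a * ((x + c) * (meixner a (c + 1) n).[x]) - x * (meixner a (c + 1) n).[x - 1] =
  a * n.+1%:R * (meixner a c n.+1).[x].
Proof.
move/(meixner_raise c n) => /(congr1 (fun p => p.[x])).
move: (meixner a (c + 1) n) (meixner a c n.+1) => p q.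
by rewrite /shiftp !hornerE horner_comp !hornerE.
Qed.

End MeixnerRelations.

(** * Differences, degrees and functionals *)

Section Size.
Variable R : numFieldType.
Implicit Types (p q r : {poly R}).

Lemma diff_poly_lead n p : (size p <= n.+2)%N ->
  (size (shiftp 1 p - p)%R <= n.+1)%N /\
  (shiftp 1 p - p)`_n = n.+1%:R * p`_n.+1.
Proof.
elim/poly_ind: p n => [|p b IH] n.
  by rewrite /shiftp comp_poly0 subr0 size_poly0 !coef0 mulr0.
move=> /leq_sizeP sz.
have szp : (size p <= n.+1)%N.
  apply/leq_sizeP => j jn; have := sz j.+1 jn.
  by rewrite coefD coefMX coefC /= addr0.
have -> : shiftp 1 (p * 'X + b%:P) - (p * 'X + b%:P) =
    (shiftp 1 p - p) * 'X + shiftp 1 p.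
  rewrite shiftpD shiftpM shiftpX shiftpC.
  have -> : ((1%:~R : R)%:P) = 1 by [].
  by ring.
have -> : shiftp 1 p = (shiftp 1 p - p) + p by rewrite subrK.
rewrite addrK; set d := shiftp 1 p - p.
case: n szp {sz} => [|n] szp.
  have d0 : d = 0.
    by rewrite /d (size1_polyC szp) shiftpC subrr.
  rewrite d0 mul0r !add0r; split=> //.
  by rewrite !coefD coefMX /= coefC /= addr0 mul1r.
have [szd ld] := IH n szp; rewrite -/d in szd ld; clearbody d; split.
  apply: (leq_trans (size_polyD _ _)); rewrite geq_max; apply/andP; split.
    apply: (leq_trans (size_polyMleq _ _)); rewrite size_polyX addn2 /=.
    by rewrite ltnS.
  apply: (leq_trans (size_polyD _ _)); rewrite geq_max szp andbT.
  exact: leq_trans szd _.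
rewrite !coefD !coefMX coefC /= addr0 ld (nth_default 0 szd).
by rewrite -[n.+2%:R]natr1; ring.
Qed.

Lemma size_diff_poly p n : size (shiftp 1 p - p) = n.+1 -> size p = n.+2.
Proof.
move=> sz; case e : (size p) => [|[|m]].
- move/eqP: e; rewrite size_poly_eq0 => /eqP p0.
  by move: sz; rewrite p0 /shiftp comp_poly0 subr0 size_poly0.
- have /size1_polyC p0 : (size p <= 1)%N by rewrite e.
  by move: sz; rewrite p0 shiftpC subrr size_poly0.
have /diff_poly_lead[szd ld] : (size p <= m.+2)%N by rewrite e.
have : (shiftp 1 p - p)`_m != 0.
  rewrite ld mulf_neq0 ?pnatr_eq0 //.
  by have := lead_coef_eq0 p; rewrite lead_coefE -size_poly_eq0 e => ->.
rewrite sz ltnS in szd; case: (ltnP n m) => [nm|]; last by lia.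
by rewrite nth_default ?eqxx // sz.
Qed.

(** Each forward difference of a Meixner polynomial is a nonzero multiple of the
    previous one (with a shifted parameter), so the degrees go up by one. *)
Lemma size_meixner a c n : a != 0 -> a != 1 -> size (meixner (a : R) c n) = n.+1.
Proof.
move=> a0 a1; elim: n c => [|n IH] c; first by rewrite meixner0 size_poly1.
apply: size_diff_poly; rewrite meixner_lower addrC addKr size_scale ?IH //.
by rewrite subr_eq0 eq_sym invr_eq1.
Qed.

Lemma functional_eq0 (L : {poly R} -> R) (e : nat -> {poly R}) : scalar L ->
  (forall n, size (e n) = n.+1) -> (forall n, L (e n) = 0) -> forall p, L p = 0.
Proof.
move=> linL sz L0 p.
elim/ltn_ind: (size p) {-2}p (leqnn (size p)) => -[|n] IH q szq.
  move: szq; rewrite leqn0 size_poly_eq0 => /eqP->.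
  by have := linL (- 1) 0 0; rewrite scaler0 addr0 mulN1r addNr.
pose z := q`_n / (e n)`_n; have en : (e n)`_n != 0.
  by have := lead_coef_eq0 (e n); rewrite lead_coefE -size_poly_eq0 sz => ->.
rewrite -[q](addrNK (z *: e n)) addrC linL L0 mulr0 add0r; apply: (IH n) => //.
apply/leq_sizeP => j; rewrite leq_eqVlt coefB coefZ => /predU1P[<-|nj].
  by rewrite divfK // subrr.
by rewrite !nth_default ?mulr0 ?subrr ?sz // (leq_trans szq).
Qed.

End Size.

(** * Moments of the Meixner functional *)

Section Functional.
Variable R : numFieldType.
Implicit Types (p q r : {poly R}) (t : R).

Definition poch t n : {poly R} := \prod_(i < n) ('X + (t + i%:R)%:P).

Lemma poch0 t : poch t 0 = 1. Proof. exact: big_ord0. Qed.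

Lemma poch_recl t n : poch t n.+1 = ('X + t%:P) * poch (t + 1) n.
Proof.
rewrite /poch big_ord_recl addr0; congr (_ * _).
by apply: eq_bigr => i _; rewrite lift0 -nat1r addrA.
Qed.

Lemma poch_recr t n : poch t n.+1 = poch t n * ('X + (t + n%:R)%:P).
Proof. by rewrite /poch big_ord_recr. Qed.

Lemma shiftp_poch t n : shiftp 1 (poch t n) = poch (t + 1) n.
Proof.
rewrite /shiftp rmorph_prod; apply: eq_bigr => i _.
by rewrite /= -/(shiftp 1 _) shiftpD shiftpX shiftpC; ring.
Qed.

Lemma pshift_poch t k : pshift t (iota 1 k) = poch (t + 1) k.
Proof.
rewrite /pshift /poch -[1%N]addn0 iotaDl big_map -{1}[k]subn0 -/(index_iota 0 k).
rewrite big_mkord; apply: eq_bigr => i _.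
by rewrite natrD; ring.
Qed.

Variables (a c : R) (rho : {scalar {poly R}}).
Hypotheses (a0 : a != 0) (a1 : a != 1).
Hypothesis orth : orthogonal_polys rho (meixner a c).

Lemma rhoZ b p : rho (b *: p) = b * rho p. Proof. exact: linearZ. Qed.
Lemma rhoB p q : rho (p - q) = rho p - rho q. Proof. exact: linearB. Qed.

(** The difference of the two sides is linear in [p], and it vanishes on the basis
    [meixner a (c + 1) n (x - 1)] because [meixner_raise] turns it into a value of
    [rho] at a Meixner polynomial of positive degree. *)
Lemma pearson p : rho ('X * p) = a * rho (('X + c%:P) * shiftp 1 p).
Proof.
pose L q := rho ('X * q) - a * rho (('X + c%:P) * shiftp 1 q).
have Lsc : scalar L.
  move=> b u v; rewrite /L mulrDr -scalerAr linearP shiftpD shiftpZ mulrDr.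
  by rewrite -scalerAr linearP /=; ring.
suff : L p = 0 by move/eqP; rewrite subr_eq0 => /eqP.
apply: (@functional_eq0 _ L (fun n => shiftp (- 1) (meixner a (c + 1) n))) => //.
  by move=> n; rewrite /shiftp size_comp_poly2 ?size_meixner // size_XaddC.
move=> n; rewrite /= /L shiftp_shiftp subrr shiftp0.
apply: oppr_inj; rewrite opprB oppr0.
rewrite -rhoZ -rhoB meixner_raise // rhoZ.
have [_ /(_ 0%N isT) + _] := orth n.+1.
by rewrite expr0 mulr1 => ->; rewrite mulr0.
Qed.

(** Summation by parts.  The parameter [d] is unrelated to the parameter [c] of
    the functional, so the lemma can be iterated on the Meixner polynomials of
    a modified functional. *)
Lemma pearson_meixner d p n :
  n.+1%:R * rho (p * meixner a d n.+1) =
  rho ((('X + d%:P) * p - ('X + c%:P) * shiftp 1 p) * meixner a (d + 1) n).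
Proof.
apply: (mulfI a0); rewrite mulrA -[LHS]rhoZ.
rewrite scalerAr -meixner_raise // mulrBr rhoB mulrBl rhoB mulrBr.
rewrite [p * ('X * _)]mulrCA pearson shiftpM shiftp_shiftp subrr shiftp0.
congr (_ - _); last by rewrite mulrA.
by rewrite -[RHS]rhoZ -scalerAr; congr (rho (_ *: _)); rewrite !mulrA [p * _]mulrC.
Qed.

(** As a function of [t], this is the recurrence in [n] of the polynomials
    [meixner a^-1 (- c - n + 1) n] at [- t], up to normalization. *)
Lemma functional_poch t n :
  (1 - a) * rho (poch (c + t) n.+1) =
  (c + t + n%:R) * rho (poch (c + t) n) - a * t * rho (poch (c + t + 1) n).
Proof.
have := pearson (poch (c + t) n); rewrite shiftp_poch.
have -> : 'X * poch (c + t) n = poch (c + t) n.+1 - (c + t + n%:R) *: poch (c + t) n.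
  by rewrite poch_recr -mul_polyC; ring.
have -> : ('X + c%:P) * poch (c + t + 1) n = poch (c + t) n.+1 - t *: poch (c + t + 1) n.
  by rewrite poch_recl -mul_polyC; ring.
rewrite !rhoB !rhoZ => e.
apply/eqP; rewrite -subr_eq0; move/eqP: e; rewrite -subr_eq0 => /eqP e.
by rewrite -[X in _ == X]e; apply/eqP; ring.
Qed.

Lemma functional_1_neq0 : rho 1 != 0.
Proof. by have [_ _] := orth 0; rewrite meixner0 expr0 mulr1. Qed.

Lemma functional_poch_neq0 n : (forall i, c != - i%:R) -> rho (poch c n) != 0.
Proof.
move=> hc; elim: n => [|n IH]; first by rewrite poch0 functional_1_neq0.
have := functional_poch 0 n; rewrite !addr0 mulr0 mul0r subr0 => e.
have : (1 - a) * rho (poch c n.+1) != 0.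
  by rewrite e mulf_neq0 // addr_eq0.
by rewrite mulf_eq0 negb_or => /andP[].
Qed.

(** Rodrigues' formula: [n] summations by parts replace [r] by its [n]-th
    difference, the constant [n! r_n].  In particular the [meixner a (c + N) n]
    are orthogonal with respect to [poch c N * rho]. *)
Lemma meixner_moment n N r : (size r <= n.+1)%N ->
  rho (poch c N * r * meixner a (c + N%:R) n) =
  (-1) ^+ n * r`_n * rho (poch c (N + n)).
Proof.
elim: n N r => [|n IH] N r szr.
  rewrite meixner0 mulr1 addn0 expr0 mul1r [in LHS](size1_polyC szr).
  by rewrite mulrC mul_polyC rhoZ.
have [szd ld] := diff_poly_lead szr.
apply: (mulfI (_ : n.+1%:R != 0 :> R)); first by rewrite pnatr_eq0.
rewrite pearson_meixner.
have -> : ('X + (c + N%:R)%:P) * (poch c N * r)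
    - ('X + c%:P) * shiftp 1 (poch c N * r) =
    - (poch c N.+1 * (shiftp 1 r - r)).
  rewrite shiftpM shiftp_poch [X in _ = - X]mulrBr {1}poch_recl poch_recr; ring.
rewrite mulNr linearN /= -addrA natr1 IH // ld addnS exprS; ring.
Qed.

(** Summation by parts against the test function [1 / (y)_{s+1}], where
    [y = x + c]: its differences are multiples of the [1 / (y)_{s+2}],
    [1 / (y)_{s+3}], and so on, and the weight [(y)_{s+1+M}] clears these denominators. *)
Lemma meixner_pole_moment M n s :
  (n`! * s`!)%:R * rho (poch (c + s%:R + 1) M * meixner a (c + s%:R + 1 + M%:R) n) =
  (n + s)`!%:R * rho (poch (c + (n + s)%:R + 1) M).
Proof.
elim: n s => [|n IH] s; first by rewrite meixner0 mulr1 fact0 mul1n.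
have e : n.+1%:R * rho (poch (c + s%:R + 1) M * meixner a (c + s%:R + 1 + M%:R) n.+1)
  = s.+1%:R * rho (poch (c + s.+1%:R + 1) M * meixner a (c + s.+1%:R + 1 + M%:R) n).
  rewrite pearson_meixner shiftp_poch -[RHS]rhoZ.
  rewrite [('X + (_ + M%:R)%:P) * _]mulrC -poch_recr poch_recl -[s.+1%:R]natr1.
  rewrite !addrA [c + s%:R + 1 + M%:R + 1]addrAC scalerAl; congr (rho (_ * _)).
  by rewrite -mul_polyC; ring.
have -> : (n.+1`! * s`!)%:R = (n`! * s`!)%:R * n.+1%:R :> R.
  by rewrite factS -natrM; congr _%:R; lia.
rewrite -mulrA e mulrA -natrM addSnnS -IH factS; congr (_%:R * _).
by lia.
Qed.

(** The moments [u_n]: the test function is [1 / (x + c)] itself. *)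
Lemma functional_pole_meixner k n :
  rho (poch (c + 1) k * meixner a (c + 1 + k%:R) n) =
  rho (poch (c + n%:R + 1) k).
Proof.
apply: (mulfI (fact_neq0 R n)).
by have := meixner_pole_moment k n 0; rewrite addr0 addn0 fact0 muln1.
Qed.

(** Both sides satisfy the recurrence of [functional_poch] in [k]. *)
Lemma functional_poch_meixner k t :
  k`!%:R * rho 1 * (meixner a^-1 (- c - k%:R + 1) k).[- t] =
  (a - 1) ^+ k * rho (poch (c + t) k).
Proof.
elim: k t => [|k IH] t; first by rewrite meixner0 hornerC poch0 expr0 fact0; ring.
have a1a : a^-1 != 0 by rewrite invr_eq0.
set d := - c - k.+1%:R + 1.
have d1 : - c - k%:R + 1 = d + 1 by rewrite /d -natr1; ring.
rewrite d1 in IH.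
have := horner_meixner_raise d k (- t) a1a.
have := IH t.
have := IH (t + 1); rewrite opprD.
have := functional_poch t k; rewrite -[c + t + 1]addrA.
set m0 := (meixner _ (d + 1) k).[- t]; set m1 := (meixner _ (d + 1) k).[- t - 1].
set m := (meixner _ d _).[_] => F I1 I0 e.
have -> : k.+1`!%:R * rho 1 * m = a * (k`!%:R * rho 1) * (a^-1 * k.+1%:R * m).
  by rewrite factS natrM; field.
rewrite -e.
transitivity ((- t + d) * (k`!%:R * rho 1 * m0) + a * t * (k`!%:R * rho 1 * m1)).
  by field.
rewrite I0 I1 exprS -[RHS]mulrA [RHS]mulrCA -[a - 1]opprB mulNr F /d -natr1; ring.
Qed.

End Functional.

(** * Difference operators with prescribed extreme coefficients *)

Section Band.
Variable R : comNzRingType.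
Implicit Types (p q A B g : {poly R}) (T : {poly R} -> {poly R}).

(** [T] has genre within [(-n, n)], with coefficients [A] and [B] at the two ends.
    Requiring [f] to vanish outside the window lets the sum be rewritten over
    larger windows, which is how operators of different widths get added. *)
Definition band n T A B := exists f : int -> {poly R},
  [/\ f (- n%:Z) = A, f n%:Z = B, forall l, (n < `|l|)%N -> f l = 0 &
      forall p, T p = \sum_(i < n.*2.+1) f (- n%:Z + i%:Z) * shiftp (- n%:Z + i%:Z) p].

Lemma band_id : band 0 id 1 1.
Proof.
exists (fun l => if l == 0 then 1 else 0); split=> // [l|p].
  by case: eqP => // ->.
by rewrite big_ord1 mul1r shiftp0.
Qed.

Lemma eq_band n T T' A B : T =1 T' -> band n T A B -> band n T' A B.
Proof. by move=> e [f [fA fB f0 fT]]; exists f; split=> // p; rewrite -e. Qed.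

Lemma bandD n T T' A A' B B' : band n T A B -> band n T' A' B' ->
  band n (fun p => T p + T' p) (A + A') (B + B').
Proof.
move=> [f [fA fB f0 fT]] [g [gA gB g0 gT]]; exists (fun l => f l + g l); split.
- by rewrite fA gA.
- by rewrite fB gB.
- by move=> l nl; rewrite f0 // g0 // addr0.
- by move=> p; rewrite fT gT -big_split; apply: eq_bigr => i _; rewrite mulrDl.
Qed.

Lemma bandM n T A B g : band n T A B ->
  band n (fun p => g * T p) (g * A) (g * B).
Proof.
move=> [f [fA fB f0 fT]]; exists (fun l => g * f l); split.
- by rewrite fA.
- by rewrite fB.
- by move=> l nl; rewrite f0 // mulr0.
- by move=> p; rewrite fT mulr_sumr; apply: eq_bigr => i _; rewrite mulrA.
Qed.

Lemma bandS n T A B : band n T A B -> band n.+1 T 0 0.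
Proof.
move=> [f [fA fB f0 fT]]; exists f; split.
- by apply: f0; lia.
- by apply: f0; lia.
- by move=> l nl; apply: f0; lia.
move=> p; rewrite doubleS big_ord_recl big_ord_recr /= /bump !leq0n !f0 ?mul0r; [|lia..].
rewrite add0r addr0 fT; apply: eq_bigr => i _.
by have -> : - n.+1%:Z + (true + i)%:Z = - n%:Z + i%:Z by lia.
Qed.

Lemma band_shift_up n T A B : band n T A B ->
  band n.+1 (fun p => shiftp 1 (T p)) 0 (shiftp 1 B).
Proof.
move=> [f [fA fB f0 fT]]; exists (fun l => shiftp 1 (f (l - 1))); split.
- by rewrite f0 ?shiftpC //; lia.
- by rewrite -fB; congr (shiftp 1 (f _)); lia.
- by move=> l nl; rewrite f0 ?shiftpC //; lia.
move=> p; rewrite doubleS 2!big_ord_recl /= /bump !leq0n !f0 ?shiftpC ?mul0r ?add0r; [|lia..].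
rewrite fT shiftp_sum; apply: eq_bigr => i _; rewrite shiftpM shiftp_shiftp.
by congr (shiftp 1 (f _) * shiftp _ p); lia.
Qed.

Lemma band_shift_down n T A B : band n T A B ->
  band n.+1 (fun p => shiftp (- 1) (T p)) (shiftp (- 1) A) 0.
Proof.
move=> [f [fA fB f0 fT]]; exists (fun l => shiftp (- 1) (f (l + 1))); split.
- by rewrite -fA; congr (shiftp (- 1) (f _)); lia.
- by rewrite f0 ?shiftpC //; lia.
- by move=> l nl; rewrite f0 ?shiftpC //; lia.
move=> p; rewrite doubleS 2!big_ord_recr /= !f0 ?shiftpC ?mul0r ?addr0; [|lia..].
rewrite fT shiftp_sum; apply: eq_bigr => i _; rewrite shiftpM shiftp_shiftp.
by congr (shiftp (- 1) (f _) * shiftp _ p); lia.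
Qed.

Lemma band_linear n T A B b p q : band n T A B -> T (b *: p + q) = b *: T p + T q.
Proof.
move=> [f [_ _ _ fT]]; rewrite !fT scaler_sumr -big_split; apply: eq_bigr => i _ /=.
by rewrite shiftpD shiftpZ mulrDr scalerAr.
Qed.

Lemma band_genre k T A B : band k.+1 T A B -> A != 0 -> B != 0 ->
  has_genre T (- k%:Z - 1) (k%:Z + 1).
Proof.
move=> [f [fA fB _ fT]] A0 B0; split; first by lia.
have e : - k%:Z - 1 = - k.+1%:Z by lia.
exists f; rewrite e; split; first by rewrite fA.
  have -> : k%:Z + 1 = k.+1%:Z by lia.
  by rewrite fB.
move=> p; rewrite fT.
by have -> : absz (k%:Z + 1 - - k.+1%:Z)%R = k.+1.*2 by lia.
Qed.

Lemma shiftp_eq0 l p : (shiftp l p == 0) = (p == 0).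
Proof.
apply/eqP/eqP => [e|->]; last exact: shiftpC.
by rewrite -[p]shiftp0 -(addNr l) -shiftp_shiftp e shiftpC.
Qed.

End Band.

(** * Polynomials in a second-order difference operator *)

Section PolyOp.
Variable R : numFieldType.
Implicit Types (p q P : {poly R}).
Variables (u v w : {poly R}).
Hypotheses (u0 : u != 0) (w0 : w != 0).

Definition op3 p := u * shiftp 1 p + v * p + w * shiftp (- 1) p.

Definition top_coef n : {poly R} := iter n (fun B => u * shiftp 1 B) 1.
Definition bot_coef n : {poly R} := iter n (fun A => w * shiftp (- 1) A) 1.

Lemma top_coef_neq0 n : top_coef n != 0.
Proof. by elim: n => [|n IH]; rewrite ?oner_eq0 //= mulf_neq0 // shiftp_eq0. Qed.
Lemma bot_coef_neq0 n : bot_coef n != 0.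
Proof. by elim: n => [|n IH]; rewrite ?oner_eq0 //= mulf_neq0 // shiftp_eq0. Qed.

Lemma band_iter_op3 n : band n (iter n op3) (bot_coef n) (top_coef n).
Proof.
elim: n => [|n IH]; first exact: band_id.
have := bandD (bandD (bandM u (band_shift_up IH)) (bandM v (bandS IH)))
              (bandM w (band_shift_down IH)).
by rewrite !mulr0 !(addr0, add0r).
Qed.

(** The operator [P(op3)]. *)
Definition poly_op P p := \sum_(i < size P) P`_i *: iter i op3 p.

(** Only the leading term of [P] reaches the ends of the window. *)
Lemma band_poly_op P n : size P = n.+1 ->
  band n (poly_op P) (lead_coef P *: bot_coef n) (lead_coef P *: top_coef n).
Proof.
rewrite lead_coefE /poly_op => -> /=; elim: n => [|n IH].
  have := bandM (P`_0)%:P (band_id R); rewrite -!mul_polyC; apply: eq_band => p.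
  by rewrite big_ord1 mul_polyC.
have := bandD (bandS IH) (bandM (P`_n.+1)%:P (band_iter_op3 n.+1)).
rewrite !add0r -!mul_polyC; apply: eq_band => p.
by rewrite [in RHS]big_ord_recr mul_polyC.
Qed.

Lemma poly_op_eigen P p t : op3 p = t *: p -> poly_op P p = P.[t] *: p.
Proof.
move=> e; rewrite /poly_op horner_coef scaler_suml; apply: eq_bigr => i _.
rewrite -scalerA; congr (_ *: _); elim: {i}(i : nat) => [|i IH].
  by rewrite scale1r.
rewrite iterS IH exprSr -scalerA -e /op3 !shiftpZ -!mul_polyC; ring.
Qed.

End PolyOp.

(** * The operator of order [2 k + 2] *)

Section BispectralOperator.
Variables (R : numFieldType) (a c : R) (k : nat).
Hypotheses (a0 : a != 0) (a1 : a != 1).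

Let C : R := c + 1 + k%:R.
Let m := meixner a C.

(** With these coefficients [meixner_op] is [(a (x + C) Delta - x nabla) / (a - 1)],
    where [Delta] and [nabla] are the forward and backward differences: [Delta]
    lowers [m n] by [meixner_lower], and [meixner_raise] brings it back. *)
Definition up_coef : {poly R} := (a / (a - 1)) *: ('X + C%:P).
Definition down_coef : {poly R} := (a - 1)^-1 *: 'X.

Definition meixner_op := op3 up_coef (- (up_coef + down_coef)) down_coef.

Lemma meixner_diff n :
  shiftp 1 (m n) - m n = (1 - a^-1) *: (meixner a (C + 1) n - m n).
Proof.
case: n => [|n]; first by rewrite /m !meixner0 (shiftpC 1 1) !subrr scaler0.
by rewrite /m meixner_pascal meixner_lower addrC addKr [_ + meixner _ _ n]addrC addrK.
Qed.

Lemma meixner_opE n : meixner_op (m n) = n%:R *: m n.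
Proof.
have am1 : a - 1 != 0 by rewrite subr_eq0.
have -> : meixner_op (m n) =
  up_coef * (shiftp 1 (m n) - m n) - down_coef * (m n - shiftp (- 1) (m n)).
  by rewrite /meixner_op /op3; ring.
case: n => [|n].
  rewrite /m !meixner0 (shiftpC 1 1) (shiftpC (- 1) 1) !subrr !mulr0 scale0r.
  by rewrite subrr.
have e : shiftp 1 (m n.+1) - m n.+1 = (1 - a^-1) *: meixner a (C + 1) n.
  by rewrite /m meixner_lower addrC addKr.
have e' : m n.+1 - shiftp (- 1) (m n.+1) =
    (1 - a^-1) *: shiftp (- 1) (meixner a (C + 1) n).
  by rewrite -shiftpZ -e shiftpD shiftpN shiftp_shiftp addNr shiftp0.
rewrite e e' /up_coef /down_coef; have := meixner_raise C n a0; rewrite -/m.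
move: (meixner _ _ _) (m _) => p q /(congr1 (fun r => a^-1 *: r)).
rewrite scalerA mulKf // => <-.
rewrite -!scalerAl -!scalerAr !scalerA scalerBr scalerA mulVf // scale1r.
have -> : a / (a - 1) * (1 - a^-1) = 1 by field; rewrite ?am1 ?a0.
have -> : (a - 1)^-1 * (1 - a^-1) = a^-1 by field; rewrite ?am1 ?a0.
by rewrite scale1r.
Qed.

(** Its value at [n] is proportional to the moment [u_n], see [pole_moment]. *)
Definition moment_poly : {poly R} :=
  meixner a^-1 (- c - k%:R + 1) k \Po (- 'X - 1).

Definition eigen_poly : {poly R} := meixner a^-1 (- c - k%:R) k.+1 \Po - 'X.

Let W n := moment_poly.[n%:R].
Let V n := eigen_poly.[n%:R].

Lemma horner_moment_poly n :
  moment_poly.[n%:R] = (meixner a^-1 (- c - k%:R + 1) k).[- n%:R - 1].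
Proof.
by rewrite /moment_poly; move: (meixner _ _ _) => p; rewrite horner_comp !hornerE.
Qed.

(** [eigen_poly] is a discrete primitive of [moment_poly]: with [1 / a] in place
    of [a], the Meixner polynomials are differences of one another. *)
Lemma horner_eigen_polyS n :
  eigen_poly.[n.+1%:R] = eigen_poly.[n%:R] + (a - 1) * moment_poly.[n%:R].
Proof.
have := meixner_lower a^-1 (- c - k%:R) k.
move=> /(congr1 (fun p => p.[- n.+1%:R])).
rewrite horner_moment_poly /eigen_poly; move: (meixner _ _ k) (meixner _ _ _) => p q.
rewrite /shiftp !horner_comp !hornerE /= invrK.
have -> : - n.+1%:R + 1 = - n%:R :> R by rewrite -natr1; ring.
have -> : - n%:R - 1 = - n.+1%:R :> R by rewrite -natr1; ring.
by move=> ->; ring.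
Qed.

Let poly_meixner_op := poly_op up_coef (- (up_coef + down_coef)) down_coef.

(** [P(N) - a Delta U(N)], where [N] is [meixner_op], [P] is [eigen_poly], [U] is
    [moment_poly] and [Delta] is the forward difference. *)
Definition bisp_op p := poly_meixner_op eigen_poly p
  + (- a) *: (shiftp 1 (poly_meixner_op moment_poly p)
               - poly_meixner_op moment_poly p).

(** The difference on the right is the sum of the [m j] for [j < n]. *)
Lemma bisp_op_meixner n :
  bisp_op (m n) = V n *: m n - ((a - 1) * W n) *: (meixner a (C + 1) n - m n).
Proof.
rewrite /bisp_op /poly_meixner_op !(poly_op_eigen _ (meixner_opE n)).
rewrite shiftpZ -scalerBr meixner_diff.
rewrite -/(V n) -/(W n); move: (m n) (meixner a (C + 1) n) => p q.
rewrite !scalerA -scaleNr; congr (_ + _ *: _).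
by field.
Qed.

Lemma up_coef_neq0 : up_coef != 0.
Proof.
by rewrite scaler_eq0 mulf_eq0 invr_eq0 subr_eq0 (negPf a0) (negPf a1)
  -size_poly_eq0 size_XaddC.
Qed.
Lemma down_coef_neq0 : down_coef != 0.
Proof.
by rewrite scaler_eq0 invr_eq0 subr_eq0 (negPf a1) polyX_eq0.
Qed.

(** [P(N)] reaches both ends of the window, and [Delta U(N)] only the upper one,
    where the two contributions have different degrees in [x]. *)
Lemma bisp_op_band : exists A B, [/\ band k.+1 bisp_op A B, A != 0 & B != 0].
Proof.
have a1a : a^-1 != 0 by rewrite invr_eq0.
have aa1 : a^-1 != 1 by rewrite invr_eq1.
have sX : size (- 'X : {poly R}) = 2 by rewrite size_polyN size_polyX.
have sX1 : size (- 'X - 1 : {poly R}) = 2.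
  by rewrite -opprD size_polyN -[1]/(1%:P) size_XaddC.
have s1 : size eigen_poly = k.+2 by rewrite size_comp_poly2 // size_meixner.
have s2 : size moment_poly = k.+1 by rewrite size_comp_poly2 // size_meixner.
set v := - (up_coef + down_coef).
have b1 := band_poly_op up_coef v down_coef s1.
have b2 := band_poly_op up_coef v down_coef s2.
have b3 := bandM (- a)%:P
  (bandD (band_shift_up b2) (bandM (- 1) (bandS b2))).
have b := bandD b1 b3.
have L1 : lead_coef eigen_poly != 0 by rewrite lead_coef_eq0 -size_poly_eq0 s1.
do 2 eexists; split; first (apply: eq_band b => p).
- by rewrite /bisp_op /poly_meixner_op mul_polyC mulN1r.
- by rewrite mulr0 !addr0 mulr0 addr0 scaler_eq0 negb_or L1 bot_coef_neq0 ?down_coef_neq0.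
rewrite mulr0 addr0 /= shiftpZ.
set t := shiftp 1 _; set l1 := lead_coef eigen_poly; set l2 := lead_coef moment_poly.
have -> : l1 *: (up_coef * t) + (- a)%:P * (l2 *: t) =
   (l1 *: up_coef - (a * l2)%:P) * t.
  by rewrite -!mul_polyC; ring.
rewrite mulf_neq0 // ?shiftp_eq0 ?top_coef_neq0 ?up_coef_neq0 //.
(* The leading term of [up_coef], of degree 1 in [x], survives the subtraction
   of a constant. *)
apply/eqP => /(congr1 (fun p : {poly R} => p`_1)).
rewrite /up_coef coefB !coefZ coefD coefX !coefC /= addr0 subr0 mulr1 => /eqP.
by rewrite !mulf_eq0 invr_eq0 subr_eq0 (negPf a0) (negPf a1) (negPf L1).
Qed.

End BispectralOperator.

(** * Uniqueness of orthogonal polynomials *)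

Section Unique.
Variables (R : fieldType) (mu : {scalar {poly R}}).
Implicit Types (p q : nat -> {poly R}) (r : {poly R}).

Lemma orthogonal_moment q n r : orthogonal_polys mu q -> (size r <= n.+1)%N ->
  mu (q n * r) = r`_n * mu (q n * 'X^n).
Proof.
move=> /(_ n)[_ low _] sz.
have er : r = \sum_(i < n.+1) r`_i *: 'X^i.
  rewrite -poly_def; apply/polyP => i; rewrite coef_poly.
  by case: ltnP => // /(leq_trans sz)/(nth_default _).
rewrite [in LHS]er mulr_sumr linear_sum big_ord_recr /= big1 ?add0r => [|i _].
  by rewrite -scalerAr linearZ.
by rewrite -scalerAr linearZ /= low ?mulr0.
Qed.

Lemma orthogonal_unique p q n : orthogonal_polys mu p -> orthogonal_polys mu q ->
  exists b, p n = b *: q n.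
Proof.
move=> op oq; exists ((p n)`_n / (q n)`_n).
have [szp _ _] := op n; have [szq _ _] := oq n.
have qn : (q n)`_n != 0.
  by have := lead_coef_eq0 (q n); rewrite lead_coefE -size_poly_eq0 szq => ->.
set b := _ / _; apply/eqP; rewrite -subr_eq0; set d := _ - _.
have szd : (size d <= n)%N.
  apply/leq_sizeP => j; rewrite leq_eqVlt coefB coefZ => /predU1P[<-|nj].
    by rewrite divfK // subrr.
  by rewrite !nth_default ?mulr0 ?subrr ?szq ?szp.
apply/negPn/negP => d0; pose j := (size d).-1.
have sj : size d = j.+1 by rewrite prednK // lt0n size_poly_eq0.
have jn : (j < n)%N by rewrite -sj.
have [szj _ nzj] := oq j.
have : mu (q j * d) = 0.
  rewrite mulrC mulrBl linearB -scalerAl [mu (b *: _)]linearZ /=.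
  have sj' : (size (q j) <= n.+1)%N by rewrite szj ltnS ltnW.
  by rewrite !(orthogonal_moment _ sj') // nth_default ?szj // !mul0r mulr0 subrr.
move/eqP; rewrite (orthogonal_moment oq) ?sj // mulf_eq0 (negPf nzj) orbF.
by rewrite -lead_coefE lead_coef_eq0 (negPf d0).
Qed.
End Unique.

(** * The orthogonal polynomials of the modified functional *)

Section PolePolynomials.
Variables (R : numFieldType) (a c : R) (k : nat) (rho : {scalar {poly R}}).
Hypotheses (a0 : a != 0) (a1 : a != 1) (hc : forall i : nat, c != - i%:R).
Hypothesis orth : orthogonal_polys rho (meixner a c).

Let C : R := c + 1 + k%:R.
Let m := meixner a C.
Let W n := (moment_poly a c k).[n%:R].
Hypothesis W_neq0 : forall n, W n != 0.

(** The combination of two consecutive Meixner polynomials that is orthogonal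
    to the constants. *)
Definition pole_polys n : {poly R} :=
  if n is n'.+1 then m n - (W n / W n') *: m n' else 1.

Lemma pole_polysS n : pole_polys n.+1 = m n.+1 - (W n.+1 / W n) *: m n.
Proof. by []. Qed.

Let mu : {scalar {poly R}} := mul_functional (pshift c (iota 1 k)) rho.

Lemma muB p q : mu (p - q) = mu p - mu q. Proof. exact: linearB. Qed.
Lemma muZ b p : mu (b *: p) = b * mu p. Proof. exact: linearZ. Qed.

Lemma pole_moment n : mu (m n) = k`!%:R * rho 1 / (a - 1) ^+ k * W n.
Proof.
rewrite /mu /= /mul_functional pshift_poch functional_pole_meixner //.
have := functional_poch_meixner a0 a1 orth k (n%:R + 1).
rewrite addrA opprD -horner_moment_poly -/(W n) => h; rewrite mulrAC h.
by rewrite mulrC mulKf // expf_neq0 // subr_eq0.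
Qed.

(** Multiplying by [x + c] turns [mu] into a Meixner functional. *)
Lemma pole_moment_mul n (r : {poly R}) : (size r <= n.+1)%N ->
  mu (m n * (('X + c%:P) * r)) = (-1) ^+ n * r`_n * rho (poch c (k.+1 + n)).
Proof.
move=> sz; rewrite -(meixner_moment a0 a1 orth _ sz) /mu /= /mul_functional.
rewrite pshift_poch poch_recl -/m.
have -> : c + k.+1%:R = C by rewrite /C -nat1r addrA.
by congr (rho _); rewrite -/m; ring.
Qed.

Lemma pole_polys_orth : orthogonal_polys mu pole_polys.
Proof.
have k0 : k`!%:R * rho 1 / (a - 1) ^+ k != 0.
  by rewrite !mulf_neq0 ?fact_neq0 ?invr_eq0 ?expf_neq0 ?subr_eq0 ?(functional_1_neq0 orth).
have sm n : size (m n) = n.+1 by rewrite size_meixner.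
case=> [|n].
  split=> //=; first by rewrite size_poly1.
  have := pole_moment 0; rewrite /m meixner0 mulr1 => ->.
  by rewrite mulf_neq0.
rewrite pole_polysS; set b := W n.+1 / W n.
have b0 : b != 0 by rewrite mulf_neq0 // invr_eq0.
have Q (r : {poly R}) : (size r <= n.+1)%N ->
    mu ((m n.+1 - b *: m n) * (('X + c%:P) * r)) =
    - (b * ((-1) ^+ n * r`_n * rho (poch c (k.+1 + n)))).
  move=> sz; rewrite mulrBl muB -[b *: _ * _]scalerAl [mu (b *: _)]muZ.
  rewrite !pole_moment_mul // ?(leq_trans sz) // (nth_default _ sz) mulr0 mul0r sub0r.
  by [].
(* Powers of [x] are reached from [1] by multiplying with [x + c]. *)
have low i : (i < n.+1)%N -> mu ((m n.+1 - b *: m n) * 'X^i) = 0.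
  elim: i => [|i IH] ni.
    rewrite expr0 mulr1 muB [mu (b *: _)]muZ !pole_moment /b.
    by rewrite mulrCA divfK // subrr.
  have -> : 'X^(i.+1) = ('X + c%:P) * 'X^i - c *: 'X^i :> {poly R}.
    by rewrite exprS -mul_polyC; ring.
  rewrite mulrBr muB -scalerAr [mu (c *: _)]muZ IH ?(ltnW ni) // mulr0 subr0.
  by rewrite Q ?size_polyXn ?coefXn; [rewrite gtn_eqF // mulr0 mul0r mulr0 oppr0|lia].
split=> //.
  by rewrite size_polyDl ?sm // size_polyN (leq_ltn_trans (size_scale_leq _ _)) ?sm.
have -> : 'X^(n.+1) = ('X + c%:P) * 'X^n - c *: 'X^n :> {poly R}.
  by rewrite exprS -mul_polyC; ring.
rewrite mulrBr muB -scalerAr [mu (c *: _)]muZ low // mulr0 subr0.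
rewrite Q ?size_polyXn // coefXn eqxx mulr1 oppr_eq0.
by rewrite mulf_neq0 // mulf_neq0 ?signr_eq0 ?(functional_poch_neq0 a0 a1 orth).
Qed.

(** The sums of lower Meixner polynomials produced by [bisp_op] on [m n.+1] and
    [m n] come with the factors [W n.+1] and [(W n.+1 / W n) W n], so their
    difference is the single term in [m n]. *)
Lemma pole_polys_eigen n : bisp_op a c k (pole_polys n) =
  (eigen_poly a c k).[n%:R] *: pole_polys n.
Proof.
have [A [B [lin _ _]]] := bisp_op_band c k a0 a1.
case: n => [|n].
  have := bisp_op_meixner c k a0 a1 0; rewrite !meixner0 => ->.
  by rewrite subrr scaler0 subr0.
rewrite pole_polysS.
have -> : m n.+1 - (W n.+1 / W n) *: m n = (- (W n.+1 / W n)) *: m n + m n.+1.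
  by rewrite scaleNr addrC.
rewrite (band_linear _ _ _ lin) !bisp_op_meixner // -/(W n) -/(W n.+1) -/C -/(m n) -/(m n.+1).
rewrite horner_eigen_polyS // meixner_pascal -/(m n.+1) -/(W n).
set P := (eigen_poly _ _ _).[_]; have := W_neq0 n.
move: (meixner a (C + 1) n) (m n) (m n.+1) (W n) (W n.+1) => M p q w w' w0.
have : w' = w' / w * w by rewrite divfK.
by move: (w' / w) => b ->; rewrite -!mul_polyC; ring.
Qed.
End PolePolynomials.

(** * The theorem *)

Unset Implicit Arguments.

Theorem corollary5p5 (R : realType) (k : nat) (a c : R)
  (rho : {scalar {poly R}}) :
  (0 < k)%N -> a != 0 -> a != 1 ->
  (forall i : nat, c != - i%:R) ->
  (forall n : nat, (1 <= n)%N ->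
     (meixner a^-1 (- c - k%:R + 1) k).[- n%:R] != 0) ->
  meixner_functional a c rho ->
  let mu : {scalar {poly R}} := mul_functional (pshift c (iota 1 k)) rho in
  (exists q : nat -> {poly R}, orthogonal_polys mu q) /\
  (exists (D : {poly R} -> {poly R}) (lambda : nat -> R),
     [/\ has_order D (2 * k + 2)%N%:Z,
         has_genre D (- k%:Z - 1) (k%:Z + 1) &
         forall q : nat -> {poly R}, orthogonal_polys mu q ->
           forall n : nat, D (q n) = lambda n *: q n]).
Proof.
move=> _ a0 a1 hc hW [orth _] mu.
have W0 n : (moment_poly a c k).[n%:R] != 0.
  by have := hW n.+1 isT; rewrite horner_moment_poly -natr1 opprD.
have op := pole_polys_orth a0 a1 hc orth W0.
split; first by exists (pole_polys a c k).
have [A [B [bD A0 B0]]] := bisp_op_band c k a0 a1.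
have gD := band_genre bD A0 B0.
exists (bisp_op a c k).
exists (fun n => (eigen_poly a c k).[n%:R]); split=> //.
  by exists (- k%:Z - 1), (k%:Z + 1); split=> //; lia.
move=> q oq n; have [b ->] := orthogonal_unique n oq op.
have := band_linear b (pole_polys a c k n) 0 bD.
rewrite addr0 => ->; rewrite (pole_polys_eigen a0 a1 W0).
have := band_linear (-1) 0 0 bD; rewrite scaler0 addr0 scaleN1r addNr => ->.
by rewrite addr0 !scalerA mulrC.
Qed.
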